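(* Consider the linear model $Y=X\beta+\epsilon$ described in the context, with $S=\mathrm{supp}(\beta)$, $s=|S|\ge 1$. Let $a\ge 0$. Let the initial estimator $\beta_{\rm init}$ be either the Dantzig selector with parameter $\lambda_n$ (in which case put $k_0=1$, $f=1$) or the Lasso with parameter $\lambda_n$ (in which case put $k_0=3$, $f=2$). Suppose that the restricted eigenvalue condition $RE(s,k_0,X)$ holds with constant $K(s,k_0)$, that $\lambda_n\ge f\,\lambda_{\sigma,a,p}$, that $s\ge K^4(s,k_0)$, and that $$\beta_{\min}:=\min_{j\in S}|\beta_j|\ \ge\ B_4\,\lambda_n\sqrt{s},\qquad B_4=4\sqrt2\,\max(K(s,k_0),1)+\max\Bigl(4K^2(s,k_0),\ \frac{\sqrt2}{f\,\Lambda_{\min}(2s)}\Bigr).$$ Then on the event $\mathcal T_a$, the multi-step procedure (described in the context) started from $\beta_{\rm init}$ returns $\hat\beta$ such that, with $I:=\mathrm{supp}(\hat\beta)$ and $B_3=(1+a)\bigl(1+1/(16f^2\Lambda_{\min}^2(2s))\bigr)$, $$S\subseteq I,\qquad |I\setminus S|<\frac{1}{16 f^2\Lambda_{\min}^2(2s)},$$ $$\|\hat\beta-\beta\|_2^2\ \le\ \frac{\lambda_{\sigma,a,p}^2\,|I|}{\Lambda_{\min}^2(|I|)}\ \le\ \frac{B_3\,(2\log p/n)\,s\,\sigma^2}{\Lambda_{\min}^2(|I|)} .$$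
   Context: Model. $p\ge n$; $X$ is a fixed real $n\times p$ matrix whose columns all have $\ell_2$ norm $\sqrt n$; $\beta\in\mathbb R^p$; $\epsilon\sim N(0,\sigma^2I_n)$ with $\sigma>0$; $Y=X\beta+\epsilon$. $\mathrm{supp}(\beta)=\{j:\beta_j\ne0\}$. For $T\subseteq\{1,\dots,p\}$, $X_T$ is the submatrix of columns indexed by $T$. Event. For $a\ge0$, $\lambda_{\sigma,a,p}=\sigma\sqrt{1+a}\sqrt{2\log p/n}$ and $\mathcal T_a=\{\epsilon:\|X^T\epsilon/n\|_\infty\le\lambda_{\sigma,a,p}\}$. A statement ''on $\mathcal T_a$'' holds for every realization $\epsilon\in\mathcal T_a$. Initial estimators. Lasso: a minimizer over $b\in\mathbb R^p$ of $\frac1{2n}\|Y-Xb\|_2^2+\lambda_n\|b\|_1$. Dantzig selector: a minimizer of $\|b\|_1$ subject to $\|\frac1nX^T(Y-Xb)\|_\infty\le\lambda_n$. Sparse eigenvalue. $\Lambda_{\min}(m)=\min\{\|X v\|_2^2/(n\|v\|_2^2): v\neq0,\ v \text{ has at most } m \text{ nonzero entries}\}$. Restricted eigenvalue condition $RE(s,k_0,X)$: $$\frac1{K(s,k_0)}:=\min_{J_0\subseteq\{1,\dots,p\},\,|J_0|\le s}\ \min_{v\ne0,\ \|v_{J_0^c}\|_1\le k_0\|v_{J_0}\|_1}\frac{\|Xv\|_2}{\sqrt n\,\|v_{J_0}\|_2}>0 .$$ (When $k_0\ge1$ this implies $\Lambda_{\min}(2s)>0$.) Multi-step procedure. Put $\hat\beta^{(0)}=\beta_{\rm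 init}$ and $\hat S_0=\{j:|\beta_{j,\rm init}|>4\lambda_n\}$. For $i=0,1$: set $t_i=4\lambda_n\sqrt{|\hat S_i|}$, $\hat S_{i+1}=\{j\in\hat S_i:|\hat\beta^{(i)}_j|\ge t_i\}$, and let $\hat\beta^{(i+1)}$ be the ordinary least squares estimator based on $I=\hat S_{i+1}$: $\hat\beta^{(i+1)}_I=(X_I^TX_I)^{-1}X_I^TY$ and zero outside $I$. Output $\hat\beta=\hat\beta^{(2)}$. *)

(* Defs.v *)
From HB Require Import structures.
From mathcomp Require Import all_boot all_order all_algebra.
From mathcomp Require Import all_classical all_reals all_analysis.

Set Implicit Arguments.
Unset Strict Implicit.
Unset Printing Implicit Defensive.

Import Order.TTheory GRing.Theory Num.Theory.

Local Open Scope classical_set_scope.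
Local Open Scope ring_scope.

Section vectors.
Context {R : realType}.

Definition l1norm m (v : 'cV[R]_m) : R := \sum_i `|v i 0|.

Definition l2norm m (v : 'cV[R]_m) : R := Num.sqrt (\sum_i v i 0 ^+ 2).

(* mx_norm is the largest absolute value of an entry. *)
Definition linfnorm m (v : 'cV[R]_m) : R := mx_norm v.

Definition supp m (v : 'cV[R]_m) : {set 'I_m} := [set j | v j 0 != 0]%SET.

(* v_J, kept in the ambient space by setting the entries outside J to 0. *)
Definition restr m (J : {set 'I_m}) (v : 'cV[R]_m) : 'cV[R]_m :=
  \col_j (if j \in J then v j 0 else 0).

Definition min_abs m (v : 'cV[R]_m) : R :=
  inf [set `|v j 0| | j in [set j | j \in supp v]].

End vectors.

Section gaussian_noise.
Context {R : realType} {d : measure_display} {T : measurableType d}.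
Context {P : probability T R}.

(* The law of eps is the n-fold product of N(0, sigma^2), i.e. the Gaussian
   law N(0, sigma^2 I_n); normal_prob takes the standard deviation. *)
Definition gaussian_noise n (eps : 'I_n -> {RV P >-> R}) (sigma : R) : Prop :=
  forall B : 'I_n -> set R, (forall i, measurable (B i)) ->
    P [set w | forall i, B i (eps i w)] =
    (\prod_i normal_prob 0%R sigma (B i))%E.

Definition realization n (eps : 'I_n -> {RV P >-> R}) (w : T) : 'cV[R]_n :=
  \col_i eps i w.

End gaussian_noise.

Section design.
Context {R : realType} {n p : nat}.
Variable X : 'M[R]_(n, p).

(* The minima below are over sets on which they are attained as soon as these
   sets are nonempty; inf is the library's total operator for them. *)
Definition Lambda_min (m : nat) : R :=
  inf [set l2norm (X *m v) ^+ 2 / (n%:R * l2norm v ^+ 2)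
      | v in [set v : 'cV[R]_p | v != 0 /\ (#|supp v| <= m)%N]].

Definition in_RE_cone (s : nat) (k0 : R) (J : {set 'I_p}) (v : 'cV[R]_p) :=
  [/\ (#|J| <= s)%N, v != 0 &
      l1norm (restr (~: J)%SET v) <= k0 * l1norm (restr J v)].

Definition RE_min (s : nat) (k0 : R) : R :=
  inf [set r | exists J v, in_RE_cone s k0 J v /\
       r = l2norm (X *m v) / (Num.sqrt n%:R * l2norm (restr J v))].

Definition RE_condition (s : nat) (k0 : R) : Prop := 0 < RE_min s k0.

Definition RE_const (s : nat) (k0 : R) : R := (RE_min s k0)^-1.

Definition lasso_objective (lambda : R) (y : 'cV[R]_n) (b : 'cV[R]_p) : R :=
  (2 * n%:R)^-1 * l2norm (y - X *m b) ^+ 2 + lambda * l1norm b.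

Definition is_lasso (lambda : R) (y : 'cV[R]_n) (b : 'cV[R]_p) : Prop :=
  forall b', lasso_objective lambda y b <= lasso_objective lambda y b'.

Definition dantzig_feasible (lambda : R) (y : 'cV[R]_n) (b : 'cV[R]_p) : Prop :=
  linfnorm (n%:R^-1 *: (X^T *m (y - X *m b))) <= lambda.

Definition is_dantzig (lambda : R) (y : 'cV[R]_n) (b : 'cV[R]_p) : Prop :=
  dantzig_feasible lambda y b /\
  forall b', dantzig_feasible lambda y b' -> l1norm b <= l1norm b'.

(* X_J : the columns of X indexed by J, in increasing order. *)
Definition subcols (J : {set 'I_p}) : 'M[R]_(n, #|J|) :=
  colsub (fun k : 'I_#|J| => enum_val k) X.

Definition gram (J : {set 'I_p}) : 'M[R]_#|J| :=
  (subcols J)^T *m subcols J.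

(* Inverse of the relabelling in subcols: u k becomes the entry indexed by the
   k-th element of J, and the entries outside J are 0. *)
Definition extend0 (J : {set 'I_p}) (u : 'cV[R]_#|J|) : 'cV[R]_p :=
  \col_j \sum_(k < #|J| | enum_val k == j) u k 0.

(* None when X_J^T X_J is singular, in which case the formula has no meaning. *)
Definition ols (y : 'cV[R]_n) (J : {set 'I_p}) : option 'cV[R]_p :=
  if gram J \in unitmx
  then Some (extend0 (invmx (gram J) *m (subcols J)^T *m y))
  else None.

Definition threshold_step (lambda : R) (y : 'cV[R]_n)
    (Jb : {set 'I_p} * 'cV[R]_p) : option ({set 'I_p} * 'cV[R]_p) :=
  let: (J, b) := Jb in
  let t := 4 * lambda * Num.sqrt #|J|%:R in
  let J' := [set j in J | t <= `|b j 0|]%SET in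
  omap (pair J') (ols y J').

Definition multi_step (lambda : R) (y : 'cV[R]_n) (binit : 'cV[R]_p) :
    option 'cV[R]_p :=
  let S0 := [set j | 4 * lambda < `|binit j 0|]%SET in
  omap snd (obind (threshold_step lambda y)
                  (threshold_step lambda y (S0, binit))).

Definition lambda_univ (sigma a : R) : R :=
  sigma * Num.sqrt (1 + a) * Num.sqrt (2 * ln p%:R / n%:R).

Definition noise_event (sigma a : R) : set 'cV[R]_n :=
  [set e | linfnorm (n%:R^-1 *: (X^T *m e)) <= lambda_univ sigma a].

End design.

Arguments lambda_univ {R} n p sigma a.

Inductive init_method := Dantzig | Lasso.

Section initial_estimator.
Context {R : realType} {n p : nat}.
Variable X : 'M[R]_(n, p).

Definition is_initial (e : init_method) : R -> 'cV[R]_n -> 'cV[R]_p -> Prop :=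
  match e with Dantzig => is_dantzig X | Lasso => is_lasso X end.

Definition k0_of (e : init_method) : R :=
  match e with Dantzig => 1 | Lasso => 3 end.

Definition f_of (e : init_method) : R :=
  match e with Dantzig => 1 | Lasso => 2 end.

Definition B4 (s : nat) (e : init_method) : R :=
  let K := RE_const X s (k0_of e) in
  4 * Num.sqrt 2 * Num.max K 1 +
  Num.max (4 * K ^+ 2) (Num.sqrt 2 / (f_of e * Lambda_min X (2 * s))).

Definition B3 (s : nat) (e : init_method) (a : R) : R :=
  (1 + a) * (1 + 1 / (16 * f_of e ^+ 2 * Lambda_min X (2 * s) ^+ 2)).

End initial_estimator.

Arguments k0_of R e : clear implicits.
Arguments f_of R e : clear implicits.

(* Main.v *)
Require Import Defs.
From mathcomp Require Import all_boot all_order all_algebra.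
From mathcomp Require Import all_classical all_reals all_analysis.
From mathcomp Require Import ring lra.

Set Implicit Arguments.
Unset Strict Implicit.
Unset Printing Implicit Defensive.

Import Order.TTheory GRing.Theory Num.Theory.

Local Open Scope classical_set_scope.
Local Open Scope ring_scope.

(** Write d for the error of the initial estimator.  The restricted eigenvalue
    condition gives |d_S|_2 <= 4 K^2 lambda sqrt s and
    |d_{S^c}|_1 <= 4 K^2 lambda s.  The first bound keeps S inside the sets
    selected before and after the first refitting threshold t_0; since
    t_0 >= 4 lambda sqrt s, the second one leaves room for at most
    K^2 sqrt s <= s false positives.  Least squares on a set of at most 2s
    indices containing S has squared error at most
    lambda_univ^2 |supp h| / Lambda_min(2s)^2, where h is its error vector, so
    the second threshold 4 lambda sqrt |S_1| again keeps S and admits fewer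
    than 1 / (16 f^2 Lambda_min(2s)^2) false positives.  The degenerate case
    lambda = 0 forces p = 1, where S is everything. *)

(** * Norms, supports and Cauchy-Schwarz for column vectors *)

Section vectors.
Context {R : realType} {m : nat}.
Implicit Types (v u : 'cV[R]_m) (J : {set 'I_m}).

Lemma l2norm_ge0 v : 0 <= l2norm v.
Proof. exact: sqrtr_ge0. Qed.

Lemma sqr_l2norm v : l2norm v ^+ 2 = \sum_i v i 0 ^+ 2.
Proof. by rewrite sqr_sqrtr // sumr_ge0 // => i _; rewrite sqr_ge0. Qed.

Lemma sqr_l2norm_dot v : l2norm v ^+ 2 = (v^T *m v) 0 0.
Proof. by rewrite sqr_l2norm mxE; apply: eq_bigr => i _; rewrite mxE expr2. Qed.

Lemma l2norm_eq0 v : (l2norm v == 0) = (v == 0).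
Proof.
apply/eqP/eqP => [v0|->].
  have /psumr_eq0P vi0 : \sum_i v i 0 ^+ 2 = 0 by rewrite -sqr_l2norm v0 expr0n.
  apply/matrixP => i j; rewrite ord1 mxE; apply/eqP.
  by rewrite -sqrf_eq0 vi0 // => k _; rewrite sqr_ge0.
by apply/eqP; rewrite -sqrf_eq0 sqr_l2norm big1 // => i _; rewrite mxE expr0n.
Qed.

Lemma l2norm_gt0 v : (0 < l2norm v) = (v != 0).
Proof. by rewrite lt_def l2norm_eq0 l2norm_ge0 andbT. Qed.

Lemma l1norm_ge0 v : 0 <= l1norm v.
Proof. by apply: sumr_ge0. Qed.

Lemma sum_sqr_le_l2norm J v : \sum_(j in J) v j 0 ^+ 2 <= l2norm v ^+ 2.
Proof.
rewrite sqr_l2norm [leRHS](bigID (mem J)) /= lerDl.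
by apply: sumr_ge0 => i _; rewrite sqr_ge0.
Qed.

Lemma entry_le_l2norm v j : `|v j 0| <= l2norm v.
Proof.
have := sum_sqr_le_l2norm [set j]%SET v; rewrite big_set1 => h.
by rewrite -ler_sqr ?nnegrE ?l2norm_ge0 // real_normK ?num_real.
Qed.

Lemma l1norm_split J v :
  l1norm v = \sum_(j in J) `|v j 0| + \sum_(j in ~: J) `|v j 0|.
Proof.
rewrite /l1norm (bigID (mem J)) /=; congr (_ + _).
by apply: eq_bigl => i; rewrite inE.
Qed.

Lemma l1norm_restr J v : l1norm (restr J v) = \sum_(j in J) `|v j 0|.
Proof.
rewrite [RHS]big_mkcond; apply: eq_bigr => i _.
by rewrite mxE; case: ifP => // _; rewrite normr0.
Qed.

Lemma sqr_l2norm_restr J v :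
  l2norm (restr J v) ^+ 2 = \sum_(j in J) v j 0 ^+ 2.
Proof.
rewrite sqr_l2norm [RHS]big_mkcond; apply: eq_bigr => i _.
by rewrite mxE; case: ifP => // _; rewrite expr0n.
Qed.

Lemma notin_supp v j : j \notin supp v -> v j 0 = 0.
Proof. by rewrite inE negbK => /eqP. Qed.

Lemma supp_subP J v :
  reflect (forall j, j \notin J -> v j 0 = 0) (supp v \subset J).
Proof.
apply: (iffP idP) => [sJ j jJ|h].
  by apply: notin_supp; apply: contra jJ; apply: (fintype.subsetP sJ).
by apply/fintype.subsetP => j; rewrite inE; apply: contraR => /h ->.
Qed.

Lemma l1norm_supp J v : supp v \subset J -> l1norm v = \sum_(j in J) `|v j 0|.
Proof.
move=> /supp_subP vJ; rewrite (l1norm_split J) [X in _ + X]big1 ?addr0 //.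
by move=> j; rewrite inE => /vJ ->; rewrite normr0.
Qed.

(* The squares (|J| x_i - sum x)^2 are nonnegative. *)
Lemma sqr_sum_le (x : 'I_m -> R) J :
  (\sum_(j in J) x j) ^+ 2 <= #|J|%:R * \sum_(j in J) x j ^+ 2.
Proof.
set a := \sum_(j in J) x j; set q := \sum_(j in J) x j ^+ 2.
have [J0|J_gt0] := posnP #|J|.
  rewrite /a big_pred0 ?expr0n ?J0 ?mul0r // => i.
  by rewrite (cards0_eq J0) inE.
have : 0 <= \sum_(j in J) (#|J|%:R * x j - a) ^+ 2.
  by apply: sumr_ge0 => i _; rewrite sqr_ge0.
have -> : \sum_(j in J) (#|J|%:R * x j - a) ^+ 2 =
          #|J|%:R * (#|J|%:R * q - a ^+ 2).
  under eq_bigr => i _.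
    rewrite (_ : _ ^+ 2 = #|J|%:R ^+ 2 * x i ^+ 2 + (- 2 * #|J|%:R * a) * x i
                          + a ^+ 2); last by ring.
    over.
  rewrite !big_split -!big_distrr /= sumr_const -/a -/q -mulr_natl; ring.
by rewrite pmulr_rge0 ?ltr0n // subr_ge0.
Qed.

(** Cauchy-Schwarz, stated with any upper bound [x] on the l2 norm over J so that it applies
    directly to bounds on sums of squares. *)
Lemma sum_le_sqrt_card J v (x : R) : 0 <= x ->
  \sum_(j in J) v j 0 ^+ 2 <= x ^+ 2 ->
  \sum_(j in J) `|v j 0| <= Num.sqrt #|J|%:R * x.
Proof.
move=> x0 vx; rewrite -ler_sqr ?nnegrE ?mulr_ge0 ?sqrtr_ge0 ?sumr_ge0 //.
apply: le_trans (sqr_sum_le _ _) _; rewrite exprMn sqr_sqrtr ?ler0n //.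
by rewrite ler_wpM2l ?ler0n //; under eq_bigr do rewrite real_normK ?num_real //.
Qed.

Lemma sqr_l2norm_le_l1norm v : l2norm v ^+ 2 <= l1norm v ^+ 2.
Proof.
rewrite sqr_l2norm [l1norm v ^+ 2]expr2 {1}/l1norm mulr_suml; apply: ler_sum => i _.
rewrite -[_ ^+ 2]real_normK ?num_real // expr2 ler_wpM2l // /l1norm (bigD1 i) //= lerDl.
exact: sumr_ge0.
Qed.

Lemma linfnorm_leP v (c : R) : reflect (0 <= c /\ forall j, `|v j 0| <= c)
                               (linfnorm v <= c).
Proof.
rewrite /linfnorm mx_normrE; apply: (iffP (bigmax_leP _ _ _ _)) => -[c0 vc]; split=> //.
  by move=> j; apply: (vc (j, 0)).
by case=> j k _; rewrite /= ord1.
Qed.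

Lemma dot_le u v (c : R) : (forall j, `|v j 0| <= c) ->
  `|(u^T *m v) 0 0| <= c * l1norm u.
Proof.
move=> vc; rewrite mxE mulr_sumr; apply: le_trans (ler_norm_sum _ _ _) _.
apply: ler_sum => i _; rewrite mxE normrM mulrC.
by rewrite ler_wpM2r.
Qed.

End vectors.

(** * Sparse and restricted eigenvalues as inequalities without quotients *)

Section design.
Context {R : realType} {n p : nat} (n_gt0 : (0 < n)%N) (X : 'M[R]_(n, p)).
Implicit Types (v : 'cV[R]_p) (J : {set 'I_p}).

Lemma sqr_l2norm_mulmx v :
  l2norm (X *m v) ^+ 2 = (v^T *m (X^T *m (X *m v))) 0 0.
Proof. by rewrite sqr_l2norm_dot trmx_mul !mulmxA. Qed.

Let sparse_quotients (m : nat) : set R :=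
  [set l2norm (X *m v) ^+ 2 / (n%:R * l2norm v ^+ 2)
      | v in [set v : 'cV[R]_p | v != 0 /\ (#|supp v| <= m)%N]].

Let sparse_quotients_ge0 m : lbound (sparse_quotients m) 0.
Proof.
move=> _ [v _ <-].
by apply: divr_ge0; rewrite ?(sqr_ge0, mulr_ge0, ler0n).
Qed.

(** Clearing the denominator extends the bound to v = 0, which the infimum excludes. *)
Lemma Lambda_min_le (m : nat) v : (#|supp v| <= m)%N ->
  Lambda_min X m * (n%:R * l2norm v ^+ 2) <= l2norm (X *m v) ^+ 2.
Proof.
move=> vm; have [->|v0] := eqVneq v 0.
  have -> : l2norm (0 : 'cV[R]_p) = 0 by apply/eqP; rewrite l2norm_eq0.
  by rewrite expr0n !mulr0 sqr_ge0.
rewrite -ler_pdivlMr ?(ltr0n, mulr_gt0, exprn_gt0, l2norm_gt0) //.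
by apply: ge_inf; [exists 0; exact: sparse_quotients_ge0 | exists v].
Qed.

Lemma card_supp_delta (j : 'I_p) : #|supp (delta_mx j 0 : 'cV[R]_p)| = 1%N.
Proof.
rewrite (_ : supp _ = [set j]%SET) ?cards1 //; apply/setP => i.
by rewrite !inE mxE eqxx andbT pnatr_eq0 eqb0 negbK.
Qed.

(** The infimum of an empty set is a default value; the index [j] and [0 < m] make a unit vector
    admissible, so the set is nonempty. *)
Lemma le_Lambda_min (m : nat) (j : 'I_p) (x : R) : (0 < m)%N ->
  (forall v, v != 0 -> (#|supp v| <= m)%N ->
    x * (n%:R * l2norm v ^+ 2) <= l2norm (X *m v) ^+ 2) ->
  x <= Lambda_min X m.
Proof.
move=> m0 hx; apply: lb_le_inf.
  exists (l2norm (X *m (delta_mx j 0)) ^+ 2 / (n%:R * l2norm (delta_mx j 0 : 'cV[R]_p) ^+ 2)).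
  exists (delta_mx j 0) => //; split; last by rewrite card_supp_delta.
  by apply/eqP => /matrixP/(_ j 0)/eqP; rewrite !mxE !eqxx oner_eq0.
move=> _ [v [v0 vm] <-].
by rewrite ler_pdivlMr ?hx ?(ltr0n, mulr_gt0, exprn_gt0, l2norm_gt0).
Qed.

Lemma Lambda_min_anti (m1 m2 : nat) (j : 'I_p) : (0 < m1 <= m2)%N ->
  Lambda_min X m2 <= Lambda_min X m1.
Proof.
move=> /andP[m10 m12]; apply: (le_Lambda_min j) => // v _ vm.
by apply: Lambda_min_le; apply: leq_trans m12.
Qed.

Lemma RE_const_gt0 s k0 : RE_condition X s k0 -> 0 < RE_const X s k0.
Proof. by rewrite /RE_const invr_gt0. Qed.

(** The squared form with cleared denominator stays valid when v_J = 0, where the quotient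
    degenerates. *)
Lemma RE_le s k0 J v : RE_condition X s k0 -> (#|J| <= s)%N ->
  \sum_(j in ~: J) `|v j 0| <= k0 * \sum_(j in J) `|v j 0| ->
  n%:R * \sum_(j in J) v j 0 ^+ 2 <= RE_const X s k0 ^+ 2 * l2norm (X *m v) ^+ 2.
Proof.
move=> RE Js cone.
rewrite -sqr_l2norm_restr; set x := l2norm (restr J v).
have x0 : 0 <= x by exact: l2norm_ge0.
have [->|xn0] := eqVneq x 0; first by rewrite expr0n mulr0 mulr_ge0 ?sqr_ge0.
have {xn0}x_gt0 : 0 < x by rewrite lt_neqAle eq_sym xn0.
have v0 : v != 0.
  apply: contraTneq x_gt0 => v0; rewrite -leNgt -(ler_sqr) ?nnegrE // /x.
  by rewrite sqr_l2norm_restr expr0n big1 // => j _; rewrite v0 mxE expr0n.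
have h : RE_min X s k0 <= l2norm (X *m v) / (Num.sqrt n%:R * x).
  apply: ge_inf.
    exists 0 => _ [J' [v' [_ ->]]].
    by apply: divr_ge0; rewrite ?mulr_ge0 ?l2norm_ge0 ?sqrtr_ge0.
  by exists J, v; split=> //; split; rewrite // !l1norm_restr.
have sn : 0 < Num.sqrt n%:R :> R by rewrite sqrtr_gt0 ltr0n.
move: h; rewrite ler_pdivlMr ?mulr_gt0 // => h.
have h2 : Num.sqrt n%:R * x <= RE_const X s k0 * l2norm (X *m v).
  by rewrite /RE_const ler_pdivlMl.
have : (Num.sqrt n%:R * x) ^+ 2 <= (RE_const X s k0 * l2norm (X *m v)) ^+ 2.
  have K0 := RE_const_gt0 RE.
  by rewrite ler_sqr ?nnegrE ?mulr_ge0 ?l2norm_ge0 ?(ltW x_gt0) ?(ltW sn) ?(ltW K0).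
by rewrite !exprMn sqr_sqrtr ?ler0n.
Qed.

End design.

(** * Positivity of the 2s-sparse eigenvalue *)

Section sparse_eigenvalue_of_RE.
Context {R : realType} {n p : nat} (n_gt0 : (0 < n)%N) (X : 'M[R]_(n, p)).
Context {s : nat} {k0 : R} (RE : RE_condition X s k0) (k0_ge1 : 1 <= k0).
Implicit Types (v : 'cV[R]_p) (J : {set 'I_p}).

(** With at least half of the l1 mass on J, v lies in the cone since k0 >= 1. Then |v|_2 <= |v|_1 <=
    2 |v_J|_1 <= 2 sqrt s |v_J|_2, and the restricted eigenvalue bounds the last norm. *)
Lemma RE_le_half v J : (#|J| <= s)%N ->
  \sum_(j in ~: J) `|v j 0| <= \sum_(j in J) `|v j 0| ->
  n%:R * l2norm v ^+ 2 <=
    4 * s%:R * RE_const X s k0 ^+ 2 * l2norm (X *m v) ^+ 2.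
Proof.
move=> Js vJ; set D := \sum_(j in J) _ in vJ.
have D0 : 0 <= D by exact: sumr_ge0.
have v1 : l1norm v ^+ 2 <= 4 * D ^+ 2.
  have := l1norm_ge0 v; rewrite (l1norm_split J) -/D => h; nra.
have Dq : D ^+ 2 <= s%:R * \sum_(j in J) v j 0 ^+ 2.
  apply: le_trans (sqr_sum_le _ _) _.
  under eq_bigr do rewrite real_normK ?num_real //.
  by rewrite ler_wpM2r ?ler_nat // sumr_ge0 // => i _; rewrite sqr_ge0.
have : n%:R * \sum_(j in J) v j 0 ^+ 2 <=
       RE_const X s k0 ^+ 2 * l2norm (X *m v) ^+ 2.
  by apply: RE_le => //; apply: le_trans vJ _; rewrite ler_peMl.
have v2 := sqr_l2norm_le_l1norm v.
have nR : 0 <= n%:R :> R by [].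
have sR : 0 <= s%:R :> R by [].
move: (\sum_(j in J) v j 0 ^+ 2) Dq => q Dq hq.
apply: (@le_trans _ _ (n%:R * (4 * (s%:R * q)))).
  by rewrite ler_wpM2l //; lra.
rewrite (_ : n%:R * _ = 4 * s%:R * (n%:R * q)); last by ring.
by rewrite -[leRHS]mulrA ler_wpM2l // mulr_ge0.
Qed.

(** J collects the first s elements of A, or all of A if it is smaller. *)
Lemma subset_half (A : {set 'I_p}) : (#|A| <= 2 * s)%N ->
  exists2 J : {set 'I_p}, (J \subset A) && (#|J| <= s)%N & (#|A :\: J| <= s)%N.
Proof.
move=> As; pose J := [set j in take s (enum A)]%SET.
have JA : J \subset A.
  by apply/fintype.subsetP => j; rewrite inE => /mem_take; rewrite mem_enum.
have Jc : #|J| = minn s #|A|.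
  by rewrite cardsE (card_uniqP _) ?take_uniq ?enum_uniq // size_take_min -cardE.
exists J; first by rewrite JA Jc geq_minl.
rewrite cardsD (finset.setIidPr JA) Jc; move: As.
rewrite /minn; case: ltnP => h As; first by rewrite leq_subLR addnn -mul2n.
by rewrite subnn.
Qed.

(* Of the two halves of a 2s-sparse vector, the one with the larger l1 norm
   puts the vector in the cone. *)
Lemma Lambda_min_gt0 (j : 'I_p) : (0 < s)%N -> 0 < Lambda_min X (2 * s).
Proof.
move=> s0; have K0 := RE_const_gt0 RE.
have c0 : 0 < 4 * s%:R * RE_const X s k0 ^+ 2.
  by rewrite !mulr_gt0 ?exprn_gt0 ?ltr0n.
apply: lt_le_trans (_ : (4 * s%:R * RE_const X s k0 ^+ 2)^-1 <= _).
  by rewrite invr_gt0.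
apply: (le_Lambda_min n_gt0 j); first by rewrite muln_gt0.
move=> v v0 /subset_half[J /andP[JA Js] Js'].
rewrite ler_pdivrMl //.
have [h|/ltW h] := leP (\sum_(j in ~: J) `|v j 0|) (\sum_(j in J) `|v j 0|).
  exact: (@RE_le_half _ J).
apply: (@RE_le_half _ (supp v :\: J)%SET) => //.
(* Entries off the support vanish, so this half of the support carries all the mass outside J. *)
have e1 : \sum_(j in supp v :\: J) `|v j 0| = \sum_(j in ~: J) `|v j 0|.
  rewrite [RHS](bigID (mem (supp v))) /= [X in _ + X]big1 ?addr0.
    by apply: eq_bigl => i; rewrite !inE.
  by move=> i /andP[_ /notin_supp ->]; rewrite normr0.
have := l1norm_split (supp v :\: J)%SET v; rewrite (l1norm_split J) e1.
by move=> e2; move: h e2; lra.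
Qed.

End sparse_eigenvalue_of_RE.

(** * Error bounds for the Dantzig selector and the Lasso *)

Section initial_bounds.
Context {R : realType} {n p : nat} (n_gt0 : (0 < n)%N) (X : 'M[R]_(n, p)).
Context (beta : 'cV[R]_p) (eps : 'cV[R]_n).

Let S := supp beta.
Let y := X *m beta + eps.

(** On S the triangle inequality bounds |beta_j| - |b_j|; off S, where beta vanishes, this
    difference is exactly -|b_j - beta_j|. *)
Lemma l1norm_sub_supp (b : 'cV[R]_p) :
  l1norm beta - l1norm b <=
  \sum_(j in S) `|(b - beta) j 0| - \sum_(j in ~: S) `|(b - beta) j 0|.
Proof.
rewrite (@l1norm_supp _ _ S) // (l1norm_split S b).
have -> : \sum_(j in ~: S) `|(b - beta) j 0| = \sum_(j in ~: S) `|b j 0|.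
  by apply: eq_bigr => j; rewrite inE => /notin_supp bj; rewrite !mxE bj subr0.
have : \sum_(j in S) `|beta j 0| <=
       \sum_(j in S) (`|b j 0| + `|(b - beta) j 0|).
  apply: ler_sum => j _; rewrite !mxE -[beta j 0]opprK (distrC (b j 0)).
  have := ler_normD (beta j 0 - b j 0) (b j 0); rewrite subrK opprK; lra.
rewrite big_split /=; lra.
Qed.

Lemma residualE (b : 'cV[R]_p) : y - X *m b = eps - X *m (b - beta).
Proof. by rewrite /y mulmxBr opprB addrA [eps + _]addrC. Qed.

(** The residual of beta is the noise, so beta is feasible and minimality of b gives the cone with
    constant 1. Feasibility of both bounds each entry of X^T X d / n by 2 lambda, and Hölder's
    inequality concludes. *)
Lemma dantzig_bounds (lambda : R) (b : 'cV[R]_p) :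
  linfnorm (n%:R^-1 *: (X^T *m eps)) <= lambda ->
  is_dantzig X lambda y b ->
  \sum_(j in ~: S) `|(b - beta) j 0| <= \sum_(j in S) `|(b - beta) j 0| /\
  l2norm (X *m (b - beta)) ^+ 2 / n%:R <= 2 * lambda * l1norm (b - beta).
Proof.
move=> epsl [bf bmin]; split.
  have : l1norm b <= l1norm beta.
    by apply: bmin; rewrite /dantzig_feasible residualE subrr mulmx0 subr0.
  have := l1norm_sub_supp b; lra.
rewrite sqr_l2norm_mulmx mulrC.
set d := b - beta.
have -> : n%:R^-1 * (d^T *m (X^T *m (X *m d))) 0 0 =
          (d^T *m (n%:R^-1 *: (X^T *m (X *m d)))) 0 0.
  by rewrite -scalemxAr [RHS]mxE.
apply: le_trans (ler_norm _) _; apply: dot_le => j.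
have -> : X *m d = eps - (y - X *m b) by rewrite residualE subKr.
move: bf epsl => /linfnorm_leP[_ /(_ j) h1] /linfnorm_leP[_ /(_ j) h2].
rewrite mulmxBr scalerBr mxE [X in _ + X]mxE.
by apply: le_trans (ler_normB _ _) _; lra.
Qed.

Lemma sqr_l2normB (u v : 'cV[R]_n) :
  l2norm (u - v) ^+ 2 = l2norm u ^+ 2 - 2 * (v^T *m u) 0 0 + l2norm v ^+ 2.
Proof.
rewrite !sqr_l2norm [(v^T *m u) 0 0]mxE mulr_sumr -sumrB -big_split /=.
by apply: eq_bigr => i _; rewrite !mxE; ring.
Qed.

(** When the objective at b is compared with that at beta, |eps|^2 cancels and the cross term is at
    most c |d|_1 <= (lambda / 2) |d|_1. Adding [l1norm_sub_supp] times lambda and doubling yields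
    the coefficients 3 lambda and -lambda. *)
Lemma lasso_bounds (c lambda : R) (b : 'cV[R]_p) :
  linfnorm (n%:R^-1 *: (X^T *m eps)) <= c -> 2 * c <= lambda ->
  is_lasso X lambda y b ->
  l2norm (X *m (b - beta)) ^+ 2 / n%:R <=
    3 * lambda * \sum_(j in S) `|(b - beta) j 0|
    - lambda * \sum_(j in ~: S) `|(b - beta) j 0|.
Proof.
move=> /linfnorm_leP[c0 epsc] lc /(_ beta); rewrite /lasso_objective.
rewrite !residualE subrr mulmx0 subr0; set d := b - beta.
rewrite sqr_l2normB; set u := (_ *m eps) 0 0.
have : u / n%:R <= c * l1norm d.
  have -> : u / n%:R = (d^T *m (n%:R^-1 *: (X^T *m eps))) 0 0.
    by rewrite /u trmx_mul -mulmxA -scalemxAr [RHS]mxE mulrC.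
  by apply: le_trans (ler_norm _) _; apply: dot_le.
have := l1norm_sub_supp b; rewrite -/d (l1norm_split S d).
set D := \sum_(j in S) _; set E := \sum_(j in ~: S) _ => h1 h2.
have D0 : 0 <= D by exact: sumr_ge0.
have E0 : 0 <= E by exact: sumr_ge0.
have n0 : n%:R != 0 :> R by rewrite pnatr_eq0 -lt0n.
set q := l2norm (X *m d) ^+ 2; set e := l2norm eps ^+ 2.
rewrite (_ : (2 * n%:R)^-1 * (e - 2 * u + q) =
             (2 * n%:R)^-1 * e - u / n%:R + (q / n%:R) / 2); last by field.
move: (l1norm b) (l1norm beta) h1 (u / _) (q / _) ((2 * n%:R)^-1 * e) h2.
move=> B1 B2 h1 U Q W h2 h3.
have := ler_wpM2l (le_trans (mulr_ge0 (ler0n _ 2) c0) lc) h1.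
have := ler_wpM2r (addr_ge0 D0 E0) lc.
lra.
Qed.

(* For the Lasso, x^2 <= K^2 q <= K^2 (3 lambda sqrt(s) x - lambda E) is
   maximized over x to bound E. *)
Lemma initial_bounds (s : nat) (e : init_method) (c lambda : R)
    (b : 'cV[R]_p) (K := RE_const X s (k0_of R e)) :
  RE_condition X s (k0_of R e) -> #|S| = s ->
  linfnorm (n%:R^-1 *: (X^T *m eps)) <= c -> f_of R e * c <= lambda ->
  (lambda = 0 -> S = [set: 'I_p]%SET) ->
  is_initial X e lambda y b ->
  \sum_(j in S) (b - beta) j 0 ^+ 2 <= (4 * K ^+ 2 * lambda * Num.sqrt s%:R) ^+ 2
  /\ \sum_(j in ~: S) `|(b - beta) j 0| <= 4 * K ^+ 2 * lambda * s%:R.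
Proof.
move=> RE Ss epsc lc l0 ini; set d := b - beta.
have K0 := RE_const_gt0 RE; rewrite -/K in K0.
have c0 : 0 <= c by case/linfnorm_leP: epsc.
have lam0 : 0 <= lambda by apply: le_trans lc; case: (e) => /=; lra.
pose x2 := \sum_(j in S) d j 0 ^+ 2; pose x := Num.sqrt x2.
have x20 : 0 <= x2 by apply: sumr_ge0 => i _; rewrite sqr_ge0.
have x0 : 0 <= x by exact: sqrtr_ge0.
have xx : x ^+ 2 = x2 by exact: sqr_sqrtr.
pose D := \sum_(j in S) `|d j 0|; pose E := \sum_(j in ~: S) `|d j 0|.
have D0 : 0 <= D by exact: sumr_ge0.
have E0 : 0 <= E by exact: sumr_ge0.
pose r := Num.sqrt (s%:R : R).
have r0 : 0 <= r by exact: sqrtr_ge0.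
have rr : r ^+ 2 = s%:R by rewrite sqr_sqrtr.
have Dx : D <= r * x by rewrite /r -Ss; apply: sum_le_sqrt_card => //; rewrite xx.
pose q := l2norm (X *m d) ^+ 2 / n%:R.
have nR : 0 < n%:R :> R by rewrite ltr0n.
have xq : E <= k0_of R e * D -> x ^+ 2 <= K ^+ 2 * q.
  move=> ED; have : n%:R * x2 <= K ^+ 2 * l2norm (X *m d) ^+ 2.
    by apply: RE_le => //; rewrite Ss.
  by rewrite xx /q mulrA ler_pdivlMr // mulrC.
rewrite -/x2 -/E -xx -/r.
have K2 : 0 < K ^+ 2 by rewrite exprn_gt0.
suff [h1 h2] : x <= 4 * K ^+ 2 * lambda * r /\ E <= 4 * K ^+ 2 * lambda * s%:R.
  by split=> //; rewrite ler_sqr ?nnegrE ?(ltW K2, mulr_ge0).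
have rx0 : 0 <= r * x by exact: mulr_ge0.
have xle M : x ^+ 2 <= M * x -> 0 <= M -> x <= M.
  move=> xM M0; have [->//|xn] := eqVneq x 0.
  have x_gt0 : 0 < x by rewrite lt_def xn.
  by rewrite -(ler_pM2r x_gt0) -expr2.
clearbody K; clear RE; move: ini lc xq; case: e => /= ini lc xq.
  have epsl : linfnorm (n%:R^-1 *: (X^T *m eps)) <= lambda.
    by apply: le_trans epsc _; lra.
  have [ED] := dantzig_bounds epsl ini.
  rewrite -/d -/D -/E -/q in ED *; rewrite (l1norm_split S) -/D -/E => qle.
  (* Here q <= 2 lambda (D + E) <= 4 lambda D <= 4 lambda r x, because E <= D. *)
  have h1 : x <= 4 * K ^+ 2 * lambda * r.
    apply: xle; last by rewrite ?(ltW K2, mulr_ge0).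
    apply: le_trans (xq _) _; first by rewrite mul1r.
    rewrite (_ : _ * x = K ^+ 2 * (4 * lambda * (r * x))); last by ring.
    rewrite ler_pM2l //; apply: le_trans qle _.
    rewrite (_ : 4 * _ * _ = 2 * lambda * (2 * (r * x))); last by ring.
    by rewrite ler_wpM2l ?mulr_ge0 //; lra.
  split=> //; apply: le_trans ED (le_trans Dx _).
  by rewrite -rr (expr2 r) mulrA mulrC ler_wpM2r.
have qle := lasso_bounds epsc lc ini.
rewrite -/d -/D -/E -/q in qle.
have q0 : 0 <= q by rewrite divr_ge0 ?sqr_ge0.
(* For lambda = 0 the basic inequality does not give the cone; instead S is everything, so E = 0,
   and q = 0. *)
have [lam_eq0|lam_neq0] := eqVneq lambda 0.
  have EE : E = 0 by rewrite /E l0 // finset.setCT big_set0.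
  rewrite EE lam_eq0 !(mulr0, mul0r) in qle xq *; split=> //.
  have := xq (mulr_ge0 (ler0n _ 3) D0).
  have -> : q = 0 by apply/eqP; rewrite eq_le q0 andbT; lra.
  rewrite mulr0 => h; have := sqr_ge0 x; nra.
have lam_gt0 : 0 < lambda by rewrite lt_neqAle eq_sym lam_neq0.
(* Since q >= 0, the basic inequality gives the cone with k0 = 3. *)
have ED : E <= 3 * D by rewrite -(ler_pM2l lam_gt0); lra.
have {xq}hx : x ^+ 2 <= K ^+ 2 * (3 * lambda * (r * x) - lambda * E).
  apply: le_trans (xq ED) _; rewrite ler_pM2l //; apply: le_trans qle _.
  by rewrite lerD2r ler_wpM2l // mulr_ge0.
have KE : 0 <= K ^+ 2 * (lambda * E) by rewrite ?(ltW K2, mulr_ge0).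
have KL : 0 < K ^+ 2 * lambda by rewrite mulr_gt0.
split.
  apply: le_trans (_ : 3 * K ^+ 2 * lambda * r <= _).
    by apply: xle; rewrite ?(ltW K2, mulr_ge0) //; lra.
  by rewrite ler_wpM2r // ler_wpM2r // ler_wpM2r ?ltW //; lra.
(* With M = K^2 lambda r, completing the square in K^2 lambda E <= 3 M x - x^2 gives the bound 9/4
   M^2 <= 4 M^2. *)
rewrite -(ler_pM2l KL) -rr.
have := sqr_ge0 (x - 3 / 2 * (K ^+ 2 * lambda * r)).
have := sqr_ge0 (K ^+ 2 * lambda * r).
rewrite !expr2 in hx *; nra.
Qed.

End initial_bounds.

(** * Least squares on a selected index set *)

Section ols_estimator.
Context {R : realType} {n p : nat} (n_gt0 : (0 < n)%N) (X : 'M[R]_(n, p)).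
Implicit Types (J : {set 'I_p}) (y eps : 'cV[R]_n).

Lemma mul_extend0 J (u : 'cV[R]_#|J|) : X *m extend0 u = subcols X J *m u.
Proof.
apply/matrixP => i k; rewrite ord1 !mxE.
under eq_bigr do rewrite mxE mulr_sumr.
rewrite (exchange_big_dep xpredT) //=; apply: eq_bigr => l _.
by rewrite (big_pred1 (enum_val l)) ?mxE // => j; rewrite eq_sym.
Qed.

Lemma extend0_enum_val J (u : 'cV[R]_#|J|) k : extend0 u (enum_val k) 0 = u k 0.
Proof.
rewrite mxE (big_pred1 k) // => l.
by rewrite (inj_eq enum_val_inj).
Qed.

Lemma supp_extend0 J (u : 'cV[R]_#|J|) : supp (extend0 u) \subset J.
Proof.
apply/supp_subP => j jJ; rewrite mxE big_pred0 // => k.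
by apply: contraNF jJ => /eqP <-; apply: enum_valP.
Qed.

(** A nonzero kernel vector of the Gram matrix, extended by zero, would be a nonzero sparse u with
    Xu = 0. *)
Lemma gram_unitmx J (m : nat) : (#|J| <= m)%N -> 0 < Lambda_min X m ->
  gram X J \in unitmx.
Proof.
move=> Jm L0; rewrite unitmxE unitfE; apply/negP => /det0P[v v0 vG].
pose u := extend0 v^T.
have Xu : l2norm (X *m u) ^+ 2 = 0.
  rewrite sqr_l2norm_dot mul_extend0 trmx_mul trmxK mulmxA.
  by rewrite -(mulmxA v) vG mul0mx mxE.
have := Lambda_min_le n_gt0 X (leq_trans (subset_leq_card (supp_extend0 v^T)) Jm).
rewrite Xu pmulr_rle0 // pmulr_rle0 ?ltr0n // => u2.
have /eqP : l2norm u ^+ 2 = 0 by apply/eqP; rewrite eq_le u2 sqr_ge0.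
rewrite sqrf_eq0 l2norm_eq0 => /eqP u0; case/eqP: v0.
apply/matrixP => i k; rewrite ord1 [RHS]mxE.
by have := extend0_enum_val v^T k; rewrite -/u u0 !mxE.
Qed.

(** Replaces the inverse formula by orthogonality of the residual to the columns in J, free of the
    relabelling of indices. *)
Lemma ols_normal_equations y J (m : nat) :
  (#|J| <= m)%N -> 0 < Lambda_min X m ->
  exists b, [/\ ols X y J = Some b, supp b \subset J &
    forall j, j \in J -> (X^T *m (y - X *m b)) j 0 = 0].
Proof.
move=> Jm L0; have G := gram_unitmx Jm L0.
rewrite /ols G; eexists; split; [by [] | exact: supp_extend0 | ].
move=> j jJ; rewrite mul_extend0.
set u := invmx _ *m _ *m y.
have e0 : (subcols X J)^T *m (y - subcols X J *m u) = 0.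
  by rewrite mulmxBr /u !mulmxA mulmxV // mul1mx subrr.
have := congr1 (fun A : 'cV[R]_#|J| => A (enum_rank_in jJ j) 0) e0.
rewrite !mxE => e1; rewrite -[RHS]e1; apply: eq_bigr => i _.
by rewrite !mxE enum_rankK_in.
Qed.

Context (beta : 'cV[R]_p) (eps : 'cV[R]_n).

Let y := X *m beta + eps.

(** The error h is supported in J, so the normal equations give |Xh|^2 = h^T X^T eps <= n c |h|_1 <=
    n c sqrt k |h|_2, against |Xh|^2 >= n L |h|_2^2. The error sparsity k and the eigenvalue level l
    are kept apart: selection takes l = 2s with varying k, the final bound k = l = |I|. *)
Lemma ols_error J (m : nat) (c : R) :
  supp beta \subset J -> (#|J| <= m)%N -> 0 < Lambda_min X m ->
  linfnorm (n%:R^-1 *: (X^T *m eps)) <= c ->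
  exists b, [/\ ols X y J = Some b, supp b \subset J, supp (b - beta) \subset J &
    forall k l : nat, (#|supp (b - beta)| <= k <= l)%N -> 0 < Lambda_min X l ->
      l2norm (b - beta) ^+ 2 <= c ^+ 2 * k%:R / Lambda_min X l ^+ 2].
Proof.
move=> bJ Jm L0 /linfnorm_leP[c0 epsc].
have [b [bE sb nb]] := ols_normal_equations y Jm L0.
exists b; set h := b - beta.
have hJ : supp h \subset J.
  apply/supp_subP => j jJ; rewrite !mxE.
  by rewrite (supp_subP _ _ sb) // (supp_subP _ _ bJ) // subrr.
split=> // k l /andP[hk kl] Ll.
have nR : 0 < n%:R :> R by rewrite ltr0n.
have normal : (h^T *m (X^T *m (y - X *m b))) 0 0 = 0.
  rewrite mxE big1 // => j _; rewrite mxE.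
  have [/nb ->|/(supp_subP _ _ hJ) ->] := boolP (j \in J); first by rewrite mulr0.
  by rewrite mul0r.
have Xh : l2norm (X *m h) ^+ 2 = (h^T *m (X^T *m eps)) 0 0.
  move: normal; rewrite residualE -/h (mulmxBr X^T) (mulmxBr h^T) mxE [X in _ +
    X]mxE => /subr0_eq ->.
  by rewrite sqr_l2norm_mulmx.
have Xh_le : l2norm (X *m h) ^+ 2 <= n%:R * (c * l1norm h).
  rewrite Xh -ler_pdivrMl //.
  have -> : n%:R^-1 * (h^T *m (X^T *m eps)) 0 0 =
            (h^T *m (n%:R^-1 *: (X^T *m eps))) 0 0 by rewrite -scalemxAr [RHS]mxE.
  by apply: le_trans (ler_norm _) _; apply: dot_le.
set x := l2norm h; set L := Lambda_min X l in Ll *.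
have x0 : 0 <= x by exact: l2norm_ge0.
have h1 : l1norm h <= Num.sqrt k%:R * x.
  rewrite (@l1norm_supp _ _ (supp h)) //.
  apply: le_trans (sum_le_sqrt_card x0 (sum_sqr_le_l2norm _ _)) _.
  by rewrite ler_wpM2r // ler_sqrt ?ler0n // ler_nat.
have hL : L * x ^+ 2 <= c * (Num.sqrt k%:R * x).
  rewrite -(ler_pM2l nR) mulrCA; apply: le_trans (Lambda_min_le n_gt0 _ _) _.
    exact: leq_trans kl.
  by apply: le_trans Xh_le _; rewrite ler_pM2l // ler_wpM2l.
have xb : L * x <= c * Num.sqrt k%:R.
  have [->|xn] := eqVneq x 0; first by rewrite mulr0 mulr_ge0 ?sqrtr_ge0.
  have x_gt0 : 0 < x by rewrite lt_def xn.
  by rewrite -(ler_pM2r x_gt0) -!mulrA -expr2.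
rewrite ler_pdivlMr ?exprn_gt0 // -exprMn mulrC.
rewrite -[k%:R in leRHS]sqr_sqrtr ?ler0n // -[leRHS]exprMn.
by rewrite ler_sqr ?nnegrE ?mulr_ge0 ?sqrtr_ge0 ?(ltW Ll).
Qed.

End ols_estimator.

(** * The sets selected from the initial estimator *)

Section selection.
Context {R : realType} {p : nat}.
Implicit Types (v beta : 'cV[R]_p) (A : {set 'I_p}).

Lemma min_abs_le v j : j \in supp v -> min_abs v <= `|v j 0|.
Proof.
move=> jv; apply: ge_inf; last by exists j.
by exists 0 => _ [i _ <-].
Qed.

Lemma card_mul_le_sum A (F : 'I_p -> R) (t : R) :
  (forall j, j \in A -> t <= F j) -> #|A|%:R * t <= \sum_(j in A) F j.
Proof. by move=> h; rewrite mulr_natl -sumr_const; apply: ler_sum. Qed.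

(** The term 4 K^2 in the lower bound on beta absorbs the initial error, leaving |v_j| >= 4 sqrt 2
    max(K,1) lambda sqrt s on S. This exceeds both thresholds because |S0| <= 2 max(K,1)^2 s. False
    positives are counted by dividing their l1 mass by the threshold. *)
Lemma first_selection v beta (lambda K : R) (s : nat) (S := supp beta)
    (S0 := [set j | 4 * lambda < `|v j 0|]%SET)
    (S1 := [set j in S0 | 4 * lambda * Num.sqrt #|S0|%:R <= `|v j 0|]%SET) :
  0 <= lambda -> (lambda = 0 -> S = [set: 'I_p]%SET) ->
  #|S| = s -> (0 < s)%N -> 0 < K -> K ^+ 4 <= s%:R ->
  (forall j, j \in S ->
    (4 * Num.sqrt 2 * Num.max K 1 + 4 * K ^+ 2) * lambda * Num.sqrt s%:R
      <= `|beta j 0|) ->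
  \sum_(j in S) (v - beta) j 0 ^+ 2 <= (4 * K ^+ 2 * lambda * Num.sqrt s%:R) ^+ 2 ->
  \sum_(j in ~: S) `|(v - beta) j 0| <= 4 * K ^+ 2 * lambda * s%:R ->
  S \subset S1 /\ (#|S1| <= 2 * s)%N.
Proof.
move=> lam0 full Ss s0 K0 K4 bmin; set r := Num.sqrt s%:R => dS dSc.
set w := Num.sqrt 2 in bmin; set m := Num.max K 1 in bmin.
have r0 : 0 <= r by exact: sqrtr_ge0.
have rr : r ^+ 2 = s%:R by rewrite sqr_sqrtr.
have r1 : 1 <= r by rewrite -(@sqrtr1 R) ler_sqrt ?ler1n.
have w0 : 0 <= w by exact: sqrtr_ge0.
have ww : w ^+ 2 = 2 by rewrite sqr_sqrtr.
have w1 : 1 < w by rewrite -(@sqrtr1 R) ltr_sqrt ?ltr1n.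
have m1 : 1 <= m by rewrite /m le_max lexx orbT.
have mK : K <= m by rewrite /m le_max lexx.
have K2 : 0 < K ^+ 2 by rewrite exprn_gt0.
have B0 : 0 <= 4 * K ^+ 2 * lambda * r by rewrite ?(ltW K2, mulr_ge0).
have dj j : j \in S -> `|(v - beta) j 0| <= 4 * K ^+ 2 * lambda * r.
  move=> jS; rewrite -ler_sqr ?nnegrE // real_normK ?num_real //.
  apply: le_trans dS; rewrite (bigD1 j) //= lerDl.
  by apply: sumr_ge0 => i _; rewrite sqr_ge0.
have vj j : j \in S -> 4 * w * m * lambda * r <= `|v j 0|.
  move=> jS; have := bmin j jS; have := dj j jS; rewrite !mxE.
  have := ler_normB (v j 0) (v j 0 - beta j 0); rewrite subKr.
  have -> : (4 * w * m + 4 * K ^+ 2) * lambda * r = 4 * w * m * lambda * r + 4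
    * K ^+ 2 * lambda * r by ring.
  lra.
have offS j : j \in ~: S -> v j 0 = (v - beta) j 0.
  by rewrite inE => /notin_supp bj; rewrite !mxE bj subr0.
(* Both thresholds are 0 here and the count by mass breaks down; but S is everything and v agrees
   with beta on it. *)
have [lam_eq0|lam_neq0] := eqVneq lambda 0.
  split; last first.
    by apply: leq_trans (subset_leq_card (finset.subsetT _)) _; rewrite -full // Ss leq_pmull.
  apply/fintype.subsetP => j jS; rewrite !inE lam_eq0 !(mulr0, mul0r) normr_ge0 andbT.
  rewrite normr_gt0; move: (dj j jS) (jS); rewrite lam_eq0 !(mulr0, mul0r) !mxE inE.
  by rewrite normr_le0 subr_eq0 => /eqP ->.
have lam_gt0 : 0 < lambda by rewrite lt_def lam_neq0.
have SS0 : S \subset S0.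
  apply/fintype.subsetP => j jS; rewrite inE; apply: lt_le_trans (vj j jS).
  have mr : 1 <= m * r by rewrite -[1]mulr1 ler_pM.
  have wmr : 1 < w * (m * r) by apply: lt_le_trans w1 _; rewrite ler_peMr.
  by rewrite (_ : 4 * w * m * lambda * r = 4 * lambda * (w * (m * r)));
    [rewrite ltr_pMr // mulr_gt0 | ring].
have off_sum A : A \subset ~: S -> \sum_(j in A) `|v j 0| <= 4 * K ^+ 2 * lambda * s%:R.
  move=> AS; apply: le_trans dSc; rewrite [leRHS](bigID (mem A)) /=.
  rewrite [X in _ <= X + _](_ : _ = \sum_(j in A) `|v j 0|); last first.
    apply: eq_big => [j|j]; last by move=> /andP[/offS ->].
    by case: (boolP (j \in A)) => [/(fintype.subsetP AS) ->|]; rewrite ?andbF.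
  by rewrite lerDl sumr_ge0.
have DS A : (A :\: S)%SET \subset (~: S)%SET by rewrite finset.setDE finset.subsetIr.
have cardD A : S \subset A -> #|A|%:R = s%:R + #|A :\: S|%:R :> R.
  by move=> SA; rewrite -natrD -Ss -[in LHS](cardsID S A) (finset.setIidPr SA).
(* Each false positive exceeds 4 lambda, so there are at most K^2 s of them, and (1 + K^2) s <= 2
   max(K,1)^2 s. *)
have S0_card : #|S0|%:R <= (w * m * r) ^+ 2.
  have : #|S0 :\: S|%:R * (4 * lambda) <= 4 * K ^+ 2 * lambda * s%:R.
    apply: le_trans (off_sum _ (DS S0)); apply: card_mul_le_sum => j.
    by rewrite !inE => /andP[_ /ltW].
  rewrite (_ : 4 * K ^+ 2 * lambda * s%:R = K ^+ 2 * s%:R * (4 * lambda)); last by ring.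
  rewrite ler_pM2r ?mulr_gt0 // => h.
  rewrite cardD // !exprMn ww rr.
  have : K ^+ 2 <= m ^+ 2 by nra.
  have : 1 <= m ^+ 2 by nra.
  have : 0 <= s%:R :> R by [].
  nra.
set q := Num.sqrt #|S0|%:R in S1 *.
have q_le : q <= w * m * r.
  by rewrite -[leRHS]ger0_norm ?mulr_ge0 ?(le_trans _ m1) // -sqrtr_sqr ler_sqrt ?sqr_ge0.
have rq : r <= q by rewrite ler_sqrt // ler_nat -Ss subset_leq_card.
have SS1 : S \subset S1.
  apply/fintype.subsetP => j jS; rewrite inE (fintype.subsetP SS0) //=.
  apply: le_trans (vj j jS).
  rewrite (_ : 4 * w * m * lambda * r = 4 * lambda * (w * m * r)); last by ring.
  by rewrite ler_wpM2l // mulr_ge0.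
split=> //.
suff : #|S1 :\: S|%:R <= s%:R :> R.
  by move=> h; rewrite -(ler_nat R) natrM cardD // [leRHS]mulr_natl mulr2n lerD2l.
have : #|S1 :\: S|%:R * (4 * lambda * q) <= 4 * K ^+ 2 * lambda * s%:R.
  apply: le_trans (off_sum _ (DS S1)); apply: card_mul_le_sum => j.
  by rewrite !inE => /andP[_ /andP[_]].
rewrite (_ : _ * (4 * _ * q) = 4 * lambda * (#|S1 :\: S|%:R * q)); last by ring.
rewrite (_ : 4 * K ^+ 2 * lambda * s%:R = 4 * lambda * (K ^+ 2 * s%:R)); last by ring.
rewrite ler_pM2l ?mulr_gt0 //; set N := _%:R => h.
have N0 : 0 <= N by exact: ler0n.
(* The condition K^4 <= s enters here: N r <= N q <= K^2 s <= r s, and r cancels. *)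
have Kr : K ^+ 2 <= r.
  by rewrite -ler_sqr ?nnegrE ?(ltW K2) // -exprM rr.
rewrite -(ler_pM2r (lt_le_trans ltr01 r1)).
apply: le_trans (_ : N * q <= _); first by rewrite ler_wpM2l.
by apply: le_trans h _; rewrite mulrC ler_wpM2l.
Qed.

End selection.

(** * Selection after the first refit *)

Section second_selection.
Context {R : realType} {p : nat} (beta : 'cV[R]_p) (s : nat).
Context (c lambda f L B : R).

Let S := supp beta.

Hypotheses (Ss : #|S| = s) (s_gt0 : (0 < s)%N) (c_ge0 : 0 <= c).
Hypotheses (f_gt0 : 0 < f) (L_gt0 : 0 < L) (lambda_ge : f * c <= lambda).
Hypothesis (full : c = 0 -> S = [set: 'I_p]%SET).
Hypothesis beta_min : forall j, j \in S ->
  (B + Num.sqrt 2 / (f * L)) * lambda * Num.sqrt s%:R <= `|beta j 0|.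

(** The term sqrt 2 / (f L) in [beta_min] absorbs the least squares error: c <= lambda / f and k <=
    2s bound its norm, hence each entry, by lambda sqrt(2s) / (f L). *)
Lemma entry_ge_of_ols_error (b : 'cV[R]_p) (k : nat) j : (k <= 2 * s)%N ->
  l2norm (b - beta) ^+ 2 <= c ^+ 2 * k%:R / L ^+ 2 -> j \in S ->
  B * lambda * Num.sqrt s%:R <= `|b j 0|.
Proof.
move=> ks err jS.
have lam0 : 0 <= lambda by apply: le_trans lambda_ge; rewrite mulr_ge0 // ltW.
have lf : c <= lambda / f by rewrite ler_pdivlMr // mulrC.
have err1 : l2norm (b - beta) <= lambda / f * (Num.sqrt 2 * Num.sqrt s%:R) / L.
  rewrite -ler_sqr ?nnegrE ?l2norm_ge0 //; last first.
    by rewrite !mulr_ge0 ?invr_ge0 ?sqrtr_ge0 ?(ltW f_gt0) ?(ltW L_gt0).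
  apply: le_trans err _; rewrite expr_div_n ler_pM2r ?invr_gt0 ?exprn_gt0 //.
  rewrite [leRHS]exprMn ler_pM ?sqr_ge0 ?ler0n //.
    by rewrite ler_sqr ?nnegrE // (le_trans c_ge0).
  by rewrite exprMn !sqr_sqrtr ?ler0n // -natrM ler_nat.
have := entry_le_l2norm (b - beta) j; have := beta_min jS.
rewrite (_ : (B + _) * _ * _ = B * lambda * Num.sqrt s%:R +
   lambda / f * (Num.sqrt 2 * Num.sqrt s%:R) / L); last first.
  by field; rewrite !gt_eqF.
rewrite !mxE; have := ler_normB (b j 0) (b j 0 - beta j 0); rewrite subKr; lra.
Qed.

Hypothesis B_ge : 4 * Num.sqrt 2 <= B.

(* If the error h vanishes on S, then it is supported on fewer than |S1|
   entries; otherwise S \ S2 does not carry all of its mass.  Either way the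
   final inequality is strict. *)
Lemma second_selection (b : 'cV[R]_p) (S1 : {set 'I_p})
    (S2 := [set j in S1 | 4 * lambda * Num.sqrt #|S1|%:R <= `|b j 0|]%SET) :
  S \subset S1 -> (#|S1| <= 2 * s)%N -> supp (b - beta) \subset S1 ->
  (forall k, (#|supp (b - beta)| <= k <= #|S1|)%N ->
    l2norm (b - beta) ^+ 2 <= c ^+ 2 * k%:R / L ^+ 2) ->
  S \subset S2 /\ #|S2 :\: S|%:R < 1 / (16 * f ^+ 2 * L ^+ 2).
Proof.
move=> SS1 S1s hS1 err.
have lam0 : 0 <= lambda by apply: le_trans lambda_ge; rewrite mulr_ge0 // ltW.
have errM : l2norm (b - beta) ^+ 2 <= c ^+ 2 * #|S1|%:R / L ^+ 2.
  by apply: err; rewrite leqnn andbT subset_leq_card.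
split.
  apply/fintype.subsetP => j jS; rewrite inE (fintype.subsetP SS1) //=.
  apply: le_trans (entry_ge_of_ols_error S1s errM jS).
  (* Since |S1| <= 2s, the threshold is at most 4 lambda sqrt(2s), which B >= 4 sqrt 2 dominates. *)
  apply: le_trans (_ : 4 * lambda * (Num.sqrt 2 * Num.sqrt s%:R) <= _).
    rewrite ler_wpM2l ?mulr_ge0 // -sqrtrM ?ler0n // ler_sqrt ?mulr_ge0 ?ler0n //.
    by rewrite -natrM ler_nat.
  rewrite (_ : 4 * lambda * _ = 4 * Num.sqrt 2 * lambda * Num.sqrt s%:R); last by ring.
  by rewrite ler_wpM2r ?sqrtr_ge0 // ler_wpM2r.
set D := (S2 :\: S)%SET; set h := b - beta in hS1 err errM *.
have fL : 0 < 16 * f ^+ 2 * L ^+ 2 by rewrite !mulr_gt0 ?exprn_gt0.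
have [->|[i iD]] := set_0Vmem D; first by rewrite cards0 divr_gt0.
(* A false positive exists, so S is not everything and [full] excludes c = 0. *)
have c_gt0 : 0 < c.
  rewrite lt_def c_ge0 andbT; apply: contraTneq iD => /full Sfull.
  by rewrite /D Sfull !inE.
have S1_gt0 : (0 < #|S1|)%N by apply: leq_trans (subset_leq_card SS1); rewrite Ss.
have cL : 0 < c ^+ 2 / L ^+ 2 by rewrite divr_gt0 ?exprn_gt0.
(* On D beta vanishes, so h equals b there, and these entries passed the threshold. *)
have lower : #|D|%:R * (4 * lambda * Num.sqrt #|S1|%:R) ^+ 2 <=
             \sum_(j in D) h j 0 ^+ 2.
  apply: card_mul_le_sum => j; rewrite inE => /andP[jS]; rewrite inE => /andP[_ jt].
  rewrite !mxE (notin_supp jS) subr0 -[leRHS]real_normK ?num_real //.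
  by rewrite ler_sqr ?nnegrE ?mulr_ge0 ?sqrtr_ge0.
have upper : \sum_(j in D) h j 0 ^+ 2 < c ^+ 2 * #|S1|%:R / L ^+ 2.
  have [hS|] := boolP (supp h \subset (S1 :\: S)%SET).
    apply: le_lt_trans (sum_sqr_le_l2norm _ _) _.
    have lt_card : (#|S1 :\: S| < #|S1|)%N.
      rewrite -[X in (_ < X)%N](cardsID S S1) (finset.setIidPr SS1) Ss.
      by rewrite -[X in (X < _)%N]add0n ltn_add2r.
    apply: le_lt_trans (err #|S1 :\: S| _) _.
      by rewrite subset_leq_card ?(ltnW lt_card).
    by rewrite [ltLHS]mulrAC [ltRHS]mulrAC ltr_pM2l ?ltr_nat.
  case/subsetPn => j jh; rewrite inE (fintype.subsetP hS1) // andbT negbK => jS.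
  apply: lt_le_trans errM; apply: lt_le_trans (sum_sqr_le_l2norm (j |: D)%SET _).
  have jD : j \notin D by rewrite inE jS.
  rewrite big_setU1 //= ltrDr exprn_even_gt0 //=.
  by rewrite inE in jh.
have := le_lt_trans lower upper; rewrite exprMn sqr_sqrtr ?ler0n //.
set N := #|D|%:R; set M := #|S1|%:R.
rewrite ltr_pdivlMr ?exprn_gt0 // => hlt; rewrite ltr_pdivlMr //.
have N0 : 0 <= N by exact: ler0n.
have M0 : 0 < M by rewrite ltr0n.
have fc : f ^+ 2 * c ^+ 2 <= lambda ^+ 2.
  by rewrite -exprMn ler_sqr ?nnegrE // mulr_ge0 // ltW.
have cM : 0 < c ^+ 2 * M by rewrite mulr_gt0 ?exprn_gt0.
(* After scaling by c^2 M, replacing f^2 c^2 by lambda^2 reduces the goal to [hlt]. *)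
rewrite -(ltr_pM2r cM) mul1r; apply: le_lt_trans hlt.
rewrite (_ : N * _ * (c ^+ 2 * M) = 16 * N * M * L ^+ 2 * (f ^+ 2 * c ^+ 2)); last by ring.
rewrite (_ : N * _ * L ^+ 2 = 16 * N * M * L ^+ 2 * lambda ^+ 2); last by ring.
by rewrite ler_wpM2l // ?(sqr_ge0, mulr_ge0, ltW M0).
Qed.

End second_selection.

(** * The universal noise level *)

Section lambda_univ.
Context {R : realType} (n p : nat) (sigma a : R).
Hypotheses (n_gt0 : (0 < n)%N) (p_gt0 : (0 < p)%N) (sigma_gt0 : 0 < sigma).
Hypothesis a_ge0 : 0 <= a.

Lemma sqr_lambda_univ :
  lambda_univ n p sigma a ^+ 2 = (1 + a) * (2 * ln p%:R / n%:R) * sigma ^+ 2.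
Proof.
rewrite /lambda_univ !exprMn !sqr_sqrtr; first by ring.
  by rewrite divr_ge0 ?mulr_ge0 ?ln_ge0 ?ler1n.
by rewrite addr_ge0.
Qed.

Lemma lambda_univ_eq0 : lambda_univ n p sigma a = 0 -> p = 1%N.
Proof.
move=> l0; apply/eqP; rewrite eqn_leq p_gt0 andbT leqNgt; apply/negP => p1.
have : 0 < lambda_univ n p sigma a.
  by rewrite !mulr_gt0 ?sqrtr_gt0 ?divr_gt0 ?mulr_gt0 ?ln_gt0 ?ltr1n ?ltr0n
             // ltr_pwDl.
by rewrite l0 ltxx.
Qed.

End lambda_univ.

(** * Assembly of the multi-step guarantee *)

Unset Implicit Arguments.
Set Strict Implicit.

Theorem theorem1p1 (R : realType) (d : measure_display)
    (Omega : measurableType d) (P : probability Omega R)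
    (n p : nat) (n_gt0 : (0 < n)%N) (le_np : (n <= p)%N)
    (X : 'M[R]_(n, p))
    (X_col : forall j, l2norm (col j X) = Num.sqrt n%:R)
    (beta : 'cV[R]_p)
    (sigma : R) (sigma_gt0 : 0 < sigma)
    (eps : 'I_n -> {RV P >-> R}) (eps_law : gaussian_noise eps sigma)
    (s : nat) (s_def : s = #|supp beta|) (s_ge1 : (1 <= s)%N)
    (a : R) (a_ge0 : 0 <= a)
    (e : init_method) (lambda : R)
    (RE : RE_condition X s (k0_of R e))
    (lambda_ge : f_of R e * lambda_univ n p sigma a <= lambda)
    (s_ge : RE_const X s (k0_of R e) ^+ 4 <= s%:R)
    (beta_min : B4 X s e * lambda * Num.sqrt s%:R <= min_abs beta) :
  forall w : Omega,
    noise_event X sigma a (realization eps w) ->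
  forall binit : 'cV[R]_p,
    is_initial X e lambda (X *m beta + realization eps w) binit ->
  exists bhat : 'cV[R]_p,
    multi_step X lambda (X *m beta + realization eps w) binit = Some bhat /\
    let S := supp beta in
    let I := supp bhat in
    let f := f_of R e in
    let L2s := Lambda_min X (2 * s) in
    let LI := Lambda_min X #|I| in
    [/\ S \subset I,
        #|I :\: S|%:R < 1 / (16 * f ^+ 2 * L2s ^+ 2),
        l2norm (bhat - beta) ^+ 2
          <= lambda_univ n p sigma a ^+ 2 * #|I|%:R / LI ^+ 2 &
        lambda_univ n p sigma a ^+ 2 * #|I|%:R / LI ^+ 2
          <= B3 X s e a * (2 * ln p%:R / n%:R) * s%:R * sigma ^+ 2 / LI ^+ 2].
Proof.
move=> w noise binit ini.
set c := lambda_univ n p sigma a in lambda_ge noise *.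
set y := X *m beta + _ in ini *.
set K := RE_const X s (k0_of R e) in s_ge *.
set f := f_of R e in lambda_ge *; set L := Lambda_min X (2 * s).
have p_gt0 : (0 < p)%N by exact: leq_trans le_np.
have c_ge0 : 0 <= c by case/linfnorm_leP: noise.
have f_ge1 : 1 <= f by rewrite /f; case: (e) => /=; rewrite ?ler1n.
have f_gt0 : 0 < f by exact: lt_le_trans f_ge1.
have lambda_ge0 : 0 <= lambda by apply: le_trans lambda_ge; rewrite mulr_ge0 // ltW.
have Ss : #|supp beta| = s by [].
(* A zero noise level forces p = 1, and then s >= 1 leaves no index outside the support. *)
have full : c = 0 -> supp beta = [set: 'I_p]%SET.
  move=> /(lambda_univ_eq0 n_gt0 p_gt0 sigma_gt0 a_ge0) p1.
  apply/eqP; rewrite eqEcard finset.subsetT /= cardsT card_ord Ss.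
  by rewrite p1.
have fullL : lambda = 0 -> supp beta = [set: 'I_p]%SET.
  move=> l0; apply: full; apply/eqP; rewrite eq_le c_ge0 andbT.
  by rewrite -(ler_pM2l f_gt0) mulr0 -l0.
have k0_ge1 : 1 <= k0_of R e by case: (e) => /=; rewrite ?ler1n.
have K_gt0 : 0 < K := RE_const_gt0 RE.
have L_gt0 : 0 < L := Lambda_min_gt0 n_gt0 RE k0_ge1 (Ordinal p_gt0) s_ge1.
have [dS dSc] := initial_bounds n_gt0 RE Ss noise lambda_ge fullL ini.
rewrite -/K in dS dSc.
pose B := 4 * Num.sqrt 2 * Num.max K 1.
have bmin x j : x <= Num.max (4 * K ^+ 2) (Num.sqrt 2 / (f * L)) ->
    j \in supp beta -> (B + x) * lambda * Num.sqrt s%:R <= `|beta j 0|.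
  move=> xm jS; apply: le_trans (min_abs_le jS); apply: le_trans beta_min.
  by rewrite ler_wpM2r ?sqrtr_ge0 // ler_wpM2r // lerD2l.
have B_ge : 4 * Num.sqrt 2 <= B.
  by rewrite ler_peMr ?mulr_ge0 ?sqrtr_ge0 // le_max lexx orbT.
have bmin1 j : j \in supp beta ->
    (B + 4 * K ^+ 2) * lambda * Num.sqrt s%:R <= `|beta j 0|.
  by apply: bmin; rewrite le_max lexx.
have bmin2 j : j \in supp beta ->
    (B + Num.sqrt 2 / (f * L)) * lambda * Num.sqrt s%:R <= `|beta j 0|.
  by apply: bmin; rewrite le_max lexx orbT.
have [SS1 S1s] :=
  first_selection lambda_ge0 fullL Ss s_ge1 K_gt0 s_ge bmin1 dS dSc.
rewrite /multi_step /threshold_step /=.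
set S1 := [set j in _ | _]%SET in SS1 S1s *.
have [b1 [ols1 _ sh1 err1]] := ols_error n_gt0 SS1 S1s L_gt0 noise.
rewrite ols1 /=; set S2 := [set j in S1 | _]%SET.
have [SS2 S2lt] : supp beta \subset S2 /\ #|S2 :\: supp beta|%:R < 1 / (16 * f ^+ 2 * L ^+ 2).
  apply: (second_selection Ss s_ge1 c_ge0 f_gt0 L_gt0 lambda_ge full bmin2 B_ge SS1 S1s sh1).
  by move=> k /andP[k1 k2]; apply: err1 => //; rewrite k1 (leq_trans k2).
have S2s : (#|S2| <= 2 * s)%N.
  by apply: leq_trans S1s; apply: subset_leq_card; apply/fintype.subsetP => j;
    rewrite inE => /andP[].
have [b [ols2 sb sh2 err2]] := ols_error n_gt0 SS2 S2s L_gt0 noise.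
rewrite ols2 /=; exists b; split=> //.
have err2' : l2norm (b - beta) ^+ 2 <= c ^+ 2 * #|S2|%:R / L ^+ 2.
  by apply: err2; rewrite // S2s andbT subset_leq_card.
(* The fit may vanish at some indices of S2, so I can be smaller than S2; on S, however, its entries
   are at least B lambda sqrt s. For lambda = 0 the error is 0 and b = beta. *)
have SI : supp beta \subset supp b.
  apply/fintype.subsetP => j jS; rewrite inE.
  have [lam0|lam_neq0] := eqVneq lambda 0.
    have c0 : c = 0.
      by apply/eqP; rewrite eq_le c_ge0 andbT -(ler_pM2l f_gt0) mulr0 -lam0.
    have h0 : l2norm (b - beta) == 0.
      by rewrite -sqrf_eq0 eq_le sqr_ge0 andbT (le_trans err2') // c0 expr0n !mul0r.
    have -> : b = beta by apply/eqP; rewrite -subr_eq0 -l2norm_eq0.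
    by move: jS; rewrite inE.
  rewrite -normr_gt0; apply: lt_le_trans (entry_ge_of_ols_error c_ge0 f_gt0
    L_gt0 lambda_ge bmin2 S2s err2' jS).
  have lam_gt0 : 0 < lambda by rewrite lt_def lam_neq0.
  have B_gt0 : 0 < B by apply: lt_le_trans B_ge; rewrite mulr_gt0 ?sqrtr_gt0.
  by rewrite mulr_gt0 ?sqrtr_gt0 ?ltr0n // mulr_gt0.
have IS : (#|supp b :\: supp beta| <= #|S2 :\: supp beta|)%N.
  by apply: subset_leq_card; apply: finset.setSD.
have ISlt : #|supp b :\: supp beta|%:R < 1 / (16 * f ^+ 2 * L ^+ 2).
  by apply: le_lt_trans S2lt; rewrite ler_nat.
have I_gt0 : (0 < #|supp b|)%N.
  by apply: leq_trans (subset_leq_card SI); rewrite Ss.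
have Is : (#|supp b| <= 2 * s)%N by apply: leq_trans S2s; apply: subset_leq_card.
have LI_gt0 : 0 < Lambda_min X #|supp b|.
  apply: lt_le_trans L_gt0 _.
  by apply: (Lambda_min_anti n_gt0 X (Ordinal p_gt0)); rewrite I_gt0.
split=> //.
(* Both k and l are |I|: outside I, b vanishes, and so does beta because S lies in I. *)
- apply: err2 => //; rewrite leqnn andbT; apply: subset_leq_card.
  apply/supp_subP => j jI; rewrite !mxE (notin_supp jI) notin_supp ?subr0 //.
  by apply: contra jI; apply: (fintype.subsetP SI).
rewrite ler_pM2r ?invr_gt0 ?exprn_gt0 // /c sqr_lambda_univ // /B3 -/f -/L.
set q := 1 / (16 * f ^+ 2 * L ^+ 2) in ISlt *; set g := 2 * ln p%:R / n%:R.
have g0 : 0 <= g by rewrite divr_ge0 ?mulr_ge0 ?ln_ge0 ?ler1n.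
(* |I| = s + |I \ S| <= s + q <= (1 + q) s, the last step because s >= 1. *)
have Icard : #|supp b|%:R <= (1 + q) * s%:R.
  rewrite -(cardsID (supp beta) (supp b)) (finset.setIidPr SI) Ss natrD mulrDl mul1r.
  rewrite lerD2l; apply: le_trans (ltW ISlt) _.
  by rewrite ler_peMr ?ler1n // divr_ge0 // ltW // !mulr_gt0 ?exprn_gt0.
rewrite (_ : (1 + a) * (1 + q) * g * s%:R * sigma ^+ 2 =
             (1 + a) * g * sigma ^+ 2 * ((1 + q) * s%:R)); last by ring.
have a1 : 0 <= 1 + a by rewrite addr_ge0.
rewrite ler_wpM2l //; apply: mulr_ge0; last exact: sqr_ge0.
exact: mulr_ge0.
Qed.
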